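(* Let $f,g$ be linear functionals on a (not necessarily unital) complex $^*$-algebra $\mathscr{A}$. Suppose that $f$ is representable and that there is a constant $C\geq0$ such that $$|g(a)|^2\leq C f(a^*a),\qquad a\in\mathscr{A}.$$ Then there exists a representable positive functional $h$ on $\mathscr{A}$ such that $f+g+g^*+h$ is representable and $$f(a^*a)+g(b^*a)+\overline{g(b^*a)}+h(b^*b)\geq0$$ for all $a,b\in\mathscr{A}$. Furthermore, there is a smallest $h$ possessing this property.
   Context: A linear functional $f$ on a complex $^*$-algebra $\mathscr{A}$ is called representable if there are a Hilbert space $H_f$, a $^*$-homomorphism $\pi_f:\mathscr{A}\to\mathscr{B}(H_f)$ and a vector $\xi_f\in H_f$ such that $f(a)=(\pi_f(a)\xi_f\,|\,\xi_f)_f$ for all $a\in\mathscr{A}$. Equivalently, $f$ is positive ($f(a^*a)\geq0$ for all $a$), there is $C\geq0$ with $|f(a)|^2\leq Cf(a^*a)$ for all $a\in\mathscr{A}$, and for every $a\in\mathscr{A}$ there is $\lambda_a\geq0$ with $f(b^*a^*ab)\leq\lambda_af(b^*b)$ for all $b\in\mathscr{A}$. For a linear functional $g$, $g^*(a):=\overline{g(a^* )}$. The order between representable functionals is: $h\leq h'$ iff $h(a^*a)\leq h'(a^*a)$ for all $a\in\mathscr{A}$; ''smallest'' refers to this order. *)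

(* Defs.v *)
From HB Require Import structures.
From mathcomp Require Import all_boot all_order all_algebra.
From mathcomp Require Import sesquilinear.
From mathcomp Require Import complex.
From mathcomp Require Import boolp classical_sets reals topology normedtype.

Set Implicit Arguments.
Unset Strict Implicit.
Unset Printing Implicit Defensive.

Import Order.TTheory GRing.Theory Num.Theory.
Import numFieldNormedType.Exports.

Local Open Scope ring_scope.

Reserved Notation "a ** b" (at level 40, left associativity).

(* The complex numbers are R[i] with R : realType.  Its order is the partial
   order of numClosedFieldType: x <= y means that y - x is real and >= 0, so
   0 <= x includes the assertion that x is real.  Norms are R[i]-valued. *)

(* Complex *-algebras.  The rings of the library are all unital, so the
   product is introduced here on top of a complex vector space; there is no
   unit, and 0 is not excluded. *)
HB.mixin Record Lmodule_isStarAlgebra (R : realType) A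
    of GRing.Lmodule R[i] A := {
  amul : A -> A -> A;
  star : A -> A;
  amulA : associative amul;
  amulDl : left_distributive amul +%R;
  amulDr : right_distributive amul +%R;
  amulZl : forall (c : R[i]) (a b : A), amul (c *: a) b = c *: amul a b;
  amulZr : forall (c : R[i]) (a b : A), amul a (c *: b) = c *: amul a b;
  starK : involutive star;
  starD : {morph star : a b / a + b};
  starZ : forall (c : R[i]) (a : A), star (c *: a) = c^* *: star a;
  starM : forall a b : A, star (amul a b) = amul (star b) (star a)
}.

#[short(type="starAlgType")]
HB.structure Definition StarAlgebra (R : realType) :=
  { A of GRing.Lmodule R[i] A & Lmodule_isStarAlgebra R A }.

Notation "a ** b" := (amul a b) : ring_scope.

(* The inner product is linear in its first argument. *)
HB.mixin Record NormedModule_isHilbert (R : realType) H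
    of CompleteNormedModule R[i] H := {
  inner : {dot H for @Num.conj R[i]};
  inner_norm : forall x : H, `|x| ^+ 2 = inner x x
}.

#[short(type="hilbertType")]
HB.structure Definition Hilbert (R : realType) :=
  { H of CompleteNormedModule R[i] H & NormedModule_isHilbert R H }.

Notation "'[ x , y ]" := (inner x y) : ring_scope.

Section Representable.
Variables (R : realType) (A : starAlgType R).

Definition bounded_operator (H : hilbertType R) (T : {linear H -> H}) : Prop :=
  exists M : R[i], forall v : H, `|T v| <= M * `|v|.

(* The last field says that pi (star a) is the Hilbert space adjoint of pi a. *)
Record star_representation (H : hilbertType R) (pi : A -> {linear H -> H}) :
    Prop := StarRepresentation {
  rep_bounded : forall a, bounded_operator (pi a);
  rep_linear : forall v, linear (fun a => pi a v);
  rep_mul : forall a b v, pi (a ** b) v = pi a (pi b v);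
  rep_star : forall a v w, '[pi a v, w] = '[v, pi (star a) w]
}.

(* Linearity of f is not required separately: it follows from rep_linear. *)
Definition representable (f : A -> R[i]) : Prop :=
  exists (H : hilbertType R) (pi : A -> {linear H -> H}) (xi : H),
    star_representation pi /\ forall a, f a = '[pi a xi, xi].

Definition positive (f : A -> R[i]) : Prop :=
  forall a, 0 <= f (star a ** a).

Definition functional_le (f g : A -> R[i]) : Prop :=
  forall a, f (star a ** a) <= g (star a ** a).

Definition star_functional (g : A -> R[i]) : A -> R[i] :=
  fun a => (g (star a))^*.

Record dominating (f g h : A -> R[i]) : Prop := Dominating {
  dom_representable : representable h;
  dom_positive : positive h;
  dom_sum : representable (f \+ g \+ star_functional g \+ h);
  dom_ge0 : forall a b : A,
    0 <= f (star a ** a) + g (star b ** a) + (g (star b ** a))^*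
         + h (star b ** b)
}.

End Representable.

(* Main.v *)
(* Represent f as a |-> (pi a xi | xi).  The hypothesis makes pi a xi |-> g a a bounded
   functional on pi(A) xi, so g a = (pi a xi | zeta) with zeta in the closure of pi(A) xi,
   and h a = (pi a zeta | zeta) is the smallest choice: the sum f + g + g^* + h is the
   vector functional of xi + zeta, the quadratic form is |pi a xi + pi b zeta|^2, and
   letting pi a xi tend to - pi b zeta bounds any other admissible h' from below by h. *)

Require Import Defs.
From HB Require Import structures.
From mathcomp Require Import all_boot all_order all_algebra.
From mathcomp Require Import sesquilinear complex ring lra.
From mathcomp Require Import boolp classical_sets filter reals topology normedtype.

Set Implicit Arguments.
Unset Strict Implicit.
Unset Printing Implicit Defensive.

Import Order.TTheory GRing.Theory Num.Theory.
Import numFieldNormedType.Exports.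
Local Open Scope ring_scope.

Notation Re := complex.Re.
Notation Im := complex.Im.

(** * Real parts of complex numbers *)

Section ComplexParts.
Variable R : rcfType.
Implicit Types (x y : R[i]) (r : R).

Lemma ReD x y : Re (x + y) = Re x + Re y.
Proof. by case: x; case: y. Qed.

Lemma ReJ x : Re x^* = Re x.
Proof. by case: x. Qed.

Lemma Re_realM r x : Re (r%:C%C * x) = r * Re x.
Proof. by case: x => a b /=; rewrite mul0r subr0. Qed.

Lemma ge0_Re_eq x : 0 <= x -> x = (Re x)%:C%C.
Proof. by case: x => a b; rewrite lecE /= => /andP[/eqP-> _]. Qed.

Lemma ge0_Re x : 0 <= x -> 0 <= Re x.
Proof. by rewrite lecE => /andP[]. Qed.

Lemma le_Re x y : x <= y -> Re x <= Re y.
Proof. by rewrite lecE => /andP[]. Qed.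

Lemma Re_sqr_le_norm x : Re x ^+ 2 <= Re (`|x| ^+ 2).
Proof. by rewrite -add_Re2_Im2 /= lerDl sqr_ge0. Qed.

(** As [Re ('i * x)] is [- Im x], complex-linear identities can be proved on real parts alone. *)
Lemma eq_of_Re x y : Re x = Re y -> Re ('i%C * x) = Re ('i%C * y) -> x = y.
Proof.
by case: x y => [a b] [c d] /= -> ; rewrite !mul0r !mul1r !sub0r => /oppr_inj->.
Qed.

End ComplexParts.

(** * The real inner product underlying [H] *)

Section RealPart.
Variables (R : realType) (H : hilbertType R).
Implicit Types (x y z : H) (r e : R).

Definition rip x y : R := Re '[x, y].
Definition sqn x : R := rip x x.

Lemma innerC x y : '[x, y] = '[y, x]^*.
Proof. by rewrite hermC expr0 mul1r. Qed.

Lemma ripC x y : rip x y = rip y x.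
Proof. by rewrite /rip innerC ReJ. Qed.

Lemma ripDl x y z : rip (x + y) z = rip x z + rip y z.
Proof. by rewrite /rip linearDl ReD. Qed.

Lemma ripDr x y z : rip x (y + z) = rip x y + rip x z.
Proof. by rewrite !(ripC x) ripDl. Qed.

Lemma ripZl r x y : rip (r%:C%C *: x) y = r * rip x y.
Proof. by rewrite /rip linearZl_LR Re_realM. Qed.

Lemma ripZr r x y : rip x (r%:C%C *: y) = r * rip x y.
Proof. by rewrite !(ripC x) ripZl. Qed.

Lemma oppr_scale_real x : - x = (- 1)%:C%C *: x.
Proof. by rewrite rmorphN rmorph1 scaleN1r. Qed.

Lemma sqnE x : '[x, x] = (sqn x)%:C%C.
Proof. exact/ge0_Re_eq/dnorm_ge0. Qed.

Lemma sqn_ge0 x : 0 <= sqn x.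
Proof. exact/ge0_Re/dnorm_ge0. Qed.

Lemma sqn_norm x : `|x| ^+ 2 = (sqn x)%:C%C.
Proof. by rewrite inner_norm sqnE. Qed.

Lemma innerDD x y z w : '[x + y, z + w] = '[x, z] + '[x, w] + '[y, z] + '[y, w].
Proof. rewrite linearDl !linearDr /=; ring. Qed.

Lemma sqn_lt x (e : R[i]) : 0 < e -> (`|x| < e) = (sqn x < Re e ^+ 2).
Proof.
move=> e0; rewrite -(ltr_pXn2r (n := 2)) ?nnegrE ?normr_ge0 ?(ltW e0)//.
by rewrite sqn_norm [in LHS](ge0_Re_eq (ltW e0)) -rmorphXn ltcR.
Qed.

Lemma sqnDZ x y r :
  sqn (x + r%:C%C *: y) = sqn x + 2 * r * rip x y + r ^+ 2 * sqn y.
Proof.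
by rewrite /sqn !ripDl !ripDr !ripZl !ripZr (ripC y x); ring.
Qed.

(* This is [0 <= |x - e y|^2] divided by [e]. *)
Lemma rip_small x y e : 0 < e -> sqn x < e ^+ 2 -> 2 * rip x y <= e * (1 + sqn y).
Proof.
move=> e0 xe; have := sqn_ge0 (x + (- e)%:C%C *: y).
rewrite sqnDZ => h; rewrite -(ler_pM2l e0); nra.
Qed.

Lemma bounded_sqn (T : {linear H -> H}) : bounded_operator T ->
  exists2 K, 0 <= K & forall x, sqn (T x) <= K * sqn x.
Proof.
(* [M] can be any complex number when [H] is zero, hence the modulus. *)
move=> [M hM]; exists (Re (`|M| ^+ 2)).
  by rewrite -add_Re2_Im2 addr_ge0 ?sqr_ge0.
move=> x; rewrite -lecR rmorphM /= -!sqn_norm.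
rewrite -(ge0_Re_eq (exprn_ge0 2 (normr_ge0 M))) -exprMn ler_pXn2r ?nnegrE ?mulr_ge0 ?normr_ge0//.
rewrite -[X in _ * X]normr_id -normrM; apply: le_trans (hM x) _.
by rewrite real_ler_norm// ger0_real//; apply: le_trans (hM x); rewrite normr_ge0.
Qed.

End RealPart.

(** * Riesz representation by minimisation *)

(* Only the limit [z] of near-minimisers of [|T a|^2 - 2 Re (g a)] is used, so the
   range of [T] need not be closed. *)
Lemma riesz_closure (R : realType) (H : hilbertType R) (U : lmodType R[i])
    (T : {linear U -> H}) (g : {scalar U}) (C : R[i]) :
  0 <= C -> (forall a, `|g a| ^+ 2 <= C * '[T a, T a]) ->
  exists z : H, (forall e : R, 0 < e -> exists a, sqn (z - T a) < e) /\
    forall a, g a = '[T a, z].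
Proof.
move=> /ge0_Re C0 hg.
(* For the [z] sought, [J a] is [|T a - z|^2 - |z|^2]. *)
pose J a := sqn (T a) - 2 * Re (g a).
have gDZ a b r : Re (g (a + r%:C%C *: b)) = Re (g a) + r * Re (g b).
  by rewrite linearD linearZ; rewrite [LHS]ReD [X in _ + X]Re_realM.
have JD a b r : J (a + r%:C%C *: b) =
    J a + 2 * r * (rip (T a) (T b) - Re (g b)) + r ^+ 2 * sqn (T b).
  rewrite /J gDZ linearD linearZ /= sqnDZ; ring.
(* With [N = |T a|^2] and [G = Re (g a)], [2 G > N + C] would give [4 G^2 > (N + C)^2 >= 4 C N],
   against [G^2 <= C N]. *)
have lbJ a : - Re C <= J a.
  have := le_trans (Re_sqr_le_norm _) (le_Re (hg a)).
  rewrite sqnE mulrC Re_realM => h; rewrite /J.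
  have N0 := sqn_ge0 (T a).
  move: (sqn _) (Re (g a)) (Re C) C0 h N0 => N G c c0 h N0.
  rewrite lerNl opprB leNgt; apply/negP => lt_NG.
  have : 0 < (2 * G - (N + c)) * (2 * G + (N + c)) by apply: mulr_gt0; lra.
  have := sqr_ge0 (N - c); nra.
pose m := inf (range J).
have hinf : has_inf (range J).
  split; first by exists (J 0), 0.
  by exists (- Re C) => _ [a _ <-].
have mJ a : m <= J a by apply: ge_inf; [case: hinf | exists a].
have Jm e : 0 < e -> exists a, J a < m + e.
  by move=> e0; have [_ [a _ <-] h] := inf_adherent e0 hinf; exists a.
(* Parallelogram law: at the midpoint, [J] is the mean of [J a] and [J b] minus [|T b - T a|^2 / 4],
   and is at least [m]. *)
have near_min a b e : J a < m + e -> J b < m + e -> sqn (T b - T a) < 4 * e.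
  move=> ha hb; have := JD a (b - a) 1; have := JD a (b - a) (2^-1).
  have := mJ (a + (2^-1)%:C%C *: (b - a)).
  by rewrite rmorph1 scale1r (addrC a (b - a)) subrK (linearB T) /=; lra.
(* Images of sublevel sets of [J] generate a Cauchy filter, so no minimising sequence is chosen. *)
pose S e := [set v | exists2 a, v = T a & J a < m + e]%classic.
pose F := filter_from [set e : R | 0 < e]%classic S.
have FF : ProperFilter F.
  apply: filter_from_proper; last by move=> e /Jm[a ha]; exists (T a), a.
  apply: filter_from_filter; first by exists 1 => /=.
  move=> e1 e2 /= h1 h2; exists (Num.min e1 e2); first by rewrite /= lt_min h1.
  by move=> _ [a -> ha]; split; exists a => //; apply: lt_le_trans ha _;
    rewrite lerD2l ge_min lexx ?orbT.
have /cauchy_cvg Fcvg : cauchy F.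
  apply: cauchy_exP => eps eps0.
  have r0 : 0 < Re eps ^+ 2 / 4.
    by rewrite divr_gt0// exprn_gt0//; move: eps0; rewrite ltcE => /andP[].
  have [a ha] := Jm _ r0; exists (T a); exists (Re eps ^+ 2 / 4) => //.
  move=> _ [b -> hb]; rewrite -ball_normE /= sqn_lt//.
  by apply: lt_le_trans (near_min _ _ _ hb ha) _; lra.
pose z := lim F.
have zP e : 0 < e -> exists a, sqn (z - T a) < e ^+ 2 /\ J a < m + e.
  move=> e0; have e0' : 0 < e%:C%C by rewrite ltcR.
  have [d /= d0 hd] : F (ball z e%:C%C) := (fcvg_ballP z).1 Fcvg _ e0'.
  have [a ha] : exists a, J a < m + Num.min d e by apply: Jm; rewrite lt_min d0.
  exists a; split; last by apply: lt_le_trans ha _; rewrite lerD2l ge_min lexx orbT.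
  have := hd (T a); rewrite -ball_normE /= sqn_lt//; apply; exists a => //.
  by apply: lt_le_trans ha _; rewrite lerD2l ge_min lexx.
(* The increment of [J] in direction [b], with [T a] replaced by its limit [z]. An [a] from [zP]
   costs [e] for near-minimality and [e * (1 + r^2 |T b|^2)] for [rip_small], in all [e * K];
   [e = - L / K] then contradicts [L < 0]. *)
have stationary b r : 0 <= 2 * r * (rip z (T b) - Re (g b)) + r ^+ 2 * sqn (T b).
  have K0 : 0 < 2 + r ^+ 2 * sqn (T b) by rewrite ltr_pwDl// mulr_ge0 ?sqr_ge0 ?sqn_ge0.
  set K := 2 + _ in K0; set L := _ + _.
  rewrite leNgt; apply/negP => L0.
  have e0 : 0 < - L / K by rewrite divr_gt0// oppr_gt0.
  have eK : - L / K * K = - L by rewrite divfK// gt_eqF.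
  move: (- L / K) e0 eK => e e0 eK.
  have [a [az aJ]] := zP _ e0.
  have := rip_small ((- r)%:C%C *: T b) e0 az.
  have := mJ (a + r%:C%C *: b); rewrite JD.
  have -> : z - T a = z + (- 1)%:C%C *: T a by rewrite -oppr_scale_real.
  have -> y : sqn ((- r)%:C%C *: y) = r ^+ 2 * sqn y.
    by rewrite /sqn ripZl ripZr mulrA mulrNN.
  rewrite !(ripDl, ripZl, ripZr).
  move: eK; rewrite /K /L; lra.
have gRe b : Re (g b) = rip (T b) z.
  have N0 := sqn_ge0 (T b).
  have N1 : 0 < sqn (T b) + 1 by rewrite ltr_wpDl.
  (* Nearly the minimising [r]; the [+ 1] covers [T b = 0]. The value is a negative multiple of
     [q^2], so [q = 0]. *)
  have := stationary b (- (rip z (T b) - Re (g b)) / (sqn (T b) + 1)).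
  rewrite ripC; set q := _ - _ => h; apply/eqP; rewrite eq_sym -subr_eq0 -/q.
  rewrite -sqrf_eq0 eq_le sqr_ge0 andbT.
  have : 0 <= - (q ^+ 2 * (sqn (T b) + 2) / (sqn (T b) + 1) ^+ 2).
    by apply: le_trans h _; rewrite le_eqVlt; apply/orP; left; apply/eqP; field; lra.
  rewrite oppr_ge0 pmulr_lle0 ?invr_gt0 ?exprn_gt0// pmulr_lle0//; lra.
exists z; split=> [e e0|a].
  have [|a [ha _]] := zP (Num.sqrt e); first by rewrite sqrtr_gt0.
  by exists a; rewrite sqr_sqrtr ?ltW in ha.
apply: eq_of_Re; first exact: gRe.
by rewrite -[X in Re X]/('i%C *: g a) -linearZ gRe /rip linearZ linearZl_LR.
Qed.

(** * Vector functionals of a representation *)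

Section Representation.
Variables (R : realType) (A : starAlgType R) (H : hilbertType R).
Variables (pi : A -> {linear H -> H}) (hpi : star_representation pi).

Lemma orbit_linear v : exists T : {linear A -> H}, forall a, T a = pi a v.
Proof.
pose L := GRing.isLinear.Build _ A H _ (fun a => pi a v) (rep_linear hpi v).
pose T : {linear A -> H} := HB.pack (fun a => pi a v) L.
by exists T.
Qed.

Lemma vector_functional v : exists h : {scalar A}, forall a, h a = '[pi a v, v].
Proof.
have lin : scalar (fun a => '[pi a v, v]).
  by move=> c a b; rewrite (rep_linear hpi) linearPl.
pose L := GRing.isLinear.Build _ A _ _ (fun a => '[pi a v, v]) lin.
pose h : {scalar A} := HB.pack (fun a => '[pi a v, v] : R[i]^o) L.
by exists h.
Qed.

Lemma vector_functional_representable v (h : A -> R[i]) :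
  (forall a, h a = '[pi a v, v]) -> representable h.
Proof. by move=> hE; exists H, pi, v. Qed.

Lemma rep_inner_starM v w a b : '[pi (star b ** a) v, w] = '[pi a v, pi b w].
Proof. by rewrite (rep_mul hpi) (rep_star hpi) starK. Qed.

(** Taking the adjoint of a functional swaps its two vectors. *)
Lemma rep_inner_star v w a : '[pi (star a) v, w]^* = '[pi a w, v].
Proof. by rewrite -innerC -{1}[a]starK -(rep_star hpi) starK. Qed.

Variables (f g : A -> R[i]) (xi zeta : H).
Hypothesis fE : forall a, f a = '[pi a xi, xi].
Hypothesis gE : forall a, g a = '[pi a xi, zeta].

(** Completing the square: the two [g] terms are the cross terms, and any [h] enters only through
    its excess over the functional of [zeta]. *)
Lemma form_sqnE a b (h : A -> R[i]) :
  f (star a ** a) + g (star b ** a) + (g (star b ** a))^* + h (star b ** b) =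
  (sqn (pi a xi + pi b zeta))%:C%C + (h (star b ** b) - (sqn (pi b zeta))%:C%C).
Proof.
rewrite fE gE !rep_inner_starM -!sqnE innerDD -innerC; ring.
Qed.

Lemma vector_dominating (h : A -> R[i]) :
  (forall a, h a = '[pi a zeta, zeta]) -> dominating f g h.
Proof.
move=> hE; split.
- exact: vector_functional_representable hE.
- by move=> a; rewrite hE rep_inner_starM sqnE ler0c sqn_ge0.
- apply: (vector_functional_representable (v := xi + zeta)) => a /=.
  rewrite /star_functional fE gE gE hE rep_inner_star.
  rewrite (linearD (pi a)) innerDD; ring.
- move=> a b; rewrite form_sqnE hE rep_inner_starM -[X in _ - X]sqnE subrr addr0.
  by rewrite ler0c sqn_ge0.
Qed.

(* As [zeta] is a limit of vectors [pi a xi], the vectors [pi (b ** a) xi] approximate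
   [pi b zeta], and evaluating the form at [(- (b ** a), b)] leaves
   [h' (b^* b) - |pi b zeta|^2] in the limit. *)
Lemma vector_smallest (h h' : A -> R[i]) :
  (forall e : R, 0 < e -> exists a, sqn (zeta - pi a xi) < e) ->
  (forall a, h a = '[pi a zeta, zeta]) -> dominating f g h' -> functional_le h h'.
Proof.
move=> zeta_lim hE dom b; rewrite hE rep_inner_starM sqnE.
have h'0 := dom_positive dom b.
rewrite (ge0_Re_eq h'0) lecR; set c := Re _.
have [K K0 hK] := bounded_sqn (rep_bounded hpi b).
apply/ler_addgt0Pr => e e0.
have K1 : 0 < K + 1 by rewrite ltr_wpDl.
(* Applying [pi b] then costs at most [K * e / (K + 1) <= e], also when [K = 0]. *)
have [a ha] := zeta_lim _ (divr_gt0 e0 K1).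
have piN : pi (- (b ** a)) xi = - pi b (pi a xi).
  have [T TE] := orbit_linear xi.
  by rewrite -TE linearN TE (rep_mul hpi).
have piB : - pi b (pi a xi) + pi b zeta = pi b (zeta - pi a xi).
  by rewrite addrC (linearB (pi b)).
have := dom_ge0 dom (- (b ** a)) b; rewrite form_sqnE piN piB => /ge0_Re.
rewrite !ReD /= -/c.
have := hK (zeta - pi a xi).
have : K * sqn (zeta - pi a xi) <= e.
  rewrite ltr_pdivlMr// in ha.
  have := sqn_ge0 (zeta - pi a xi); nra.
lra.
Qed.

End Representation.

Theorem theorem3p4 (R : realType) (A : starAlgType R) (f g : {scalar A}) (C : R[i])
    (hf : representable f) (hC : 0 <= C)
    (hg : forall a : A, `|g a| ^+ 2 <= C * f (star a ** a)) :
  exists h : {scalar A},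
    dominating f g h /\
    forall h' : {scalar A}, dominating f g h' -> functional_le h h'.
Proof.
have [H [pi [xi [hpi fE]]]] := hf.
have [T TE] := orbit_linear hpi xi.
have [a|zeta [zeta_lim gE]] := @riesz_closure R H A T g C hC.
  (* [f (star a ** a)] is [|pi a xi|^2], so [hg] is the bound that Riesz requires. *)
  by rewrite TE -(rep_inner_starM hpi) -fE.
have [h hE] := vector_functional hpi zeta.
have {}gE a : g a = '[pi a xi, zeta] by rewrite gE TE.
exists h; split; first exact: (vector_dominating hpi fE gE hE).
move=> h'; apply: (vector_smallest hpi fE gE _ hE) => e /zeta_lim[a].
by rewrite TE; exists a.
Qed.
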